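(* Let $n,m,p\in\mathbb N$, $\Theta_1\in\mathbb S^p_{\succ0}$, $\Theta_3\in\mathbb S^m_{\preceq0}$, $\Theta_2\in\mathbb R^{p\times m}$, $\Phi\in\mathbb S^n$, $G\in\mathbb R^{n\times m}$, $H\in\mathbb R^{p\times n}$, $F\in\mathbb R^{p\times m}$. Let $$\mathcal D=\left\{\widehat\Delta\in\mathbb R^{m\times p}:\begin{bmatrix}I_p\\ \widehat\Delta\end{bmatrix}^\top\begin{bmatrix}\Theta_1^{-1}&\Theta_2\\ *&\Theta_3\end{bmatrix}\begin{bmatrix}I_p\\ \widehat\Delta\end{bmatrix}\succeq0\right\}$$ and $\mathcal F\subseteq\mathcal D$. If $$\exists\alpha>0:\quad\begin{bmatrix}I_m&-I_m-\alpha F^\top\Theta_2&\alpha F^\top\\ *&I_m-\alpha\Theta_3&\mathsf O_{m,p}\\ *&*&\alpha\Theta_1\end{bmatrix}\succ0,\tag{a}$$ then $$\Phi+\mathsf{Sy}\left[G(I_m-\Delta F)^{-1}\Delta H\right]\prec0\quad\text{for all }\Delta\in\mathcal F\tag{b}$$ (all the inverses being well defined) holds if $$\exists\kappa>0:\quad\begin{bmatrix}\Phi&G+\kappa H^\top\Theta_2&\kappa H^\top\\ *&\kappa F^\top\Theta_2+\kappa\Theta_2^\top F+\kappa\Theta_3&\kappa F^\top\\ *&*&-\kappa\Theta_1\end{bmatrix}\prec0.\tag{c}$$ Moreover, in the situation where the block $\Theta_1^{-1}$ in the definition of $\mathcal D$ is replaced by $\mathsf O_p$, the same implication is valid with (c)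 and (a) replaced, respectively, by $$\exists\kappa>0:\ \begin{bmatrix}\Phi&G+\kappa H^\top\Theta_2\\ *&\kappa F^\top\Theta_2+\kappa\Theta_2^\top F+\kappa\Theta_3\end{bmatrix}\prec0,\qquad \exists\alpha>0:\ \begin{bmatrix}I_m&-I_m-\alpha F^\top\Theta_2\\ *&I_m-\alpha\Theta_3\end{bmatrix}\succ0.$$
   Context: $\mathsf{Sy}(X)=X+X^\top$; $\mathbb S^n$ = real symmetric $n\times n$ matrices, with $\mathbb S^p_{\succ0}$ the positive definite and $\mathbb S^m_{\preceq0}$ the negative semidefinite ones; $\mathsf O_{m,p}$ zero matrix, $\mathsf O_p=\mathsf O_{p,p}$; $*$ denotes blocks determined by symmetry. *)

(* Defs.v *)
From mathcomp Require Import all_boot all_order all_algebra.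
From mathcomp Require Import boolp classical_sets reals.

Set Implicit Arguments.
Unset Strict Implicit.
Unset Printing Implicit Defensive.
Import Order.TTheory GRing.Theory Num.Theory.
Local Open Scope ring_scope.

Definition quadform (R : realType) (n : nat) (A : 'M[R]_n) (x : 'cV[R]_n) : R :=
  (x^T *m A *m x) 0 0.

Definition posdefmx (R : realType) (n : nat) (A : 'M[R]_n) : Prop :=
  A \is symmetricmx /\ forall x : 'cV[R]_n, x != 0 -> 0 < quadform A x.

Definition possemidefmx (R : realType) (n : nat) (A : 'M[R]_n) : Prop :=
  A \is symmetricmx /\ forall x : 'cV[R]_n, 0 <= quadform A x.

Definition negdefmx (R : realType) (n : nat) (A : 'M[R]_n) : Prop :=
  A \is symmetricmx /\ forall x : 'cV[R]_n, x != 0 -> quadform A x < 0.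

Definition negsemidefmx (R : realType) (n : nat) (A : 'M[R]_n) : Prop :=
  A \is symmetricmx /\ forall x : 'cV[R]_n, quadform A x <= 0.

Definition Sy (R : realType) (n : nat) (X : 'M[R]_n) : 'M[R]_n := X + X^T.

(* [[A, B], [*, D]] *)
Definition symblock2 (R : realType) (n1 n2 : nat)
    (A : 'M[R]_n1) (B : 'M[R]_(n1, n2)) (D : 'M[R]_n2) : 'M[R]_(n1 + n2) :=
  block_mx A B B^T D.

(* [[A, B, C], [*, D, E], [*, *, K]] *)
Definition symblock3 (R : realType) (n1 n2 n3 : nat)
    (A : 'M[R]_n1) (B : 'M[R]_(n1, n2)) (C : 'M[R]_(n1, n3))
    (D : 'M[R]_n2) (E : 'M[R]_(n2, n3)) (K : 'M[R]_n3) : 'M[R]_(n1 + n2 + n3) :=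
  symblock2 (symblock2 A B D) (col_mx C E) K.

(* The upper-left block T1 of the multiplier is left as a parameter: it is
   used both with the inverse of Theta1 and with 0. *)
Definition uncertainty_set (R : realType) (m p : nat)
    (T1 : 'M[R]_p) (Theta2 : 'M[R]_(p, m)) (Theta3 : 'M[R]_m) :
    set 'M[R]_(m, p) :=
  [set Delta | possemidefmx ((col_mx 1%:M Delta)^T *m
     symblock2 T1 Theta2 Theta3 *m col_mx 1%:M Delta)]%classic.

(* Main.v *)
Require Import Defs.
From mathcomp Require Import all_boot all_order all_algebra.
From mathcomp Require Import boolp classical_sets reals.
From mathcomp Require Import ring lra.
Set Implicit Arguments.
Unset Strict Implicit.
Unset Printing Implicit Defensive.
Import Order.TTheory GRing.Theory Num.Theory.
Local Open Scope ring_scope.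

(** The argument is the S-procedure carried out on explicit test vectors.
    Write [M y w] for the value at [(y, w)] of the quadratic form of the
    multiplier with upper-left block [invmx Theta1] or [0].  Membership of
    [Delta] in the uncertainty set says that [M y (Delta *m y)] is nonnegative
    for all [y] ([uncertainty_setP]).

    Well-posedness: a vector [x] with [x = Delta *m F *m x] gives
    [0 <= M (F *m x) x].  On the other hand, at [(x, x)] the identity blocks of
    the matrix in [alpha] cancel, and its form reduces to
    [- alpha * M (F *m x) x] ([quadform_wellposed]); hence [x = 0].

    Robust inequality: given [xi], put
    [w = invmx (1%:M - Delta *m F) *m Delta *m H *m xi].  Then
    [w = Delta *m (H *m xi + F *m w)], and the form of the matrix in [kappa] at
    [(xi, w)] is the sum of the form of
    [Phi + Sy (G *m invmx (1%:M - Delta *m F) *m Delta *m H)] at [xi] and of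
    [kappa * M (H *m xi + F *m w) w] ([quadform_robust]).  The sum is negative
    and its second term is nonnegative, so the first one is negative.

    These two identities are exact for the block [0].  For [invmx Theta1], the
    matrices have a third block, tested at [- invmx Theta1 *m F *m x],
    respectively [invmx Theta1 *m (H *m xi + F *m w)]: this completes the square
    and contributes exactly the missing term of [invmx Theta1]
    ([quadform_symblock3_schur]). *)

(** * Bilinear and quadratic forms of matrices *)

(** Polarised version of [quadform], for rectangular matrices: expanding every
    quadratic form into such values leaves scalar identities for [ring]. *)
Definition bilform (R : realType) (m n : nat) (A : 'M[R]_(m, n))
    (x : 'cV[R]_m) (y : 'cV[R]_n) : R := (x^T *m A *m y) 0 0.

Section BilinearForm.
Variable R : realType.
Implicit Types m n k : nat.

Lemma quadformE n (A : 'M[R]_n) x : quadform A x = bilform A x x.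
Proof. by []. Qed.

Lemma bilform_trmx m n (A : 'M[R]_(m, n)) x y :
  bilform A^T x y = bilform A y x.
Proof.
rewrite /bilform -[in RHS](trmxK (y^T *m A *m x)) [in RHS]mxE.
by rewrite !trmx_mul trmxK mulmxA.
Qed.

Lemma bilformDm m n (A B : 'M[R]_(m, n)) x y :
  bilform (A + B) x y = bilform A x y + bilform B x y.
Proof. by rewrite /bilform mulmxDr mulmxDl mxE. Qed.

Lemma bilformNm m n (A : 'M[R]_(m, n)) x y :
  bilform (- A) x y = - bilform A x y.
Proof. by rewrite /bilform mulmxN mulNmx mxE. Qed.

Lemma bilformZm m n a (A : 'M[R]_(m, n)) x y :
  bilform (a *: A) x y = a * bilform A x y.
Proof. by rewrite /bilform -scalemxAr -scalemxAl mxE. Qed.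

Lemma bilform0m m n x y : bilform (0 : 'M[R]_(m, n)) x y = 0.
Proof. by rewrite /bilform mulmx0 mul0mx mxE. Qed.

Lemma bilformDl m n (A : 'M[R]_(m, n)) x x' y :
  bilform A (x + x') y = bilform A x y + bilform A x' y.
Proof. by rewrite /bilform linearD /= !mulmxDl mxE. Qed.

Lemma bilformZl m n a (A : 'M[R]_(m, n)) x y :
  bilform A (a *: x) y = a * bilform A x y.
Proof. by rewrite /bilform linearZ /= -!scalemxAl mxE. Qed.

Lemma bilformZr m n a (A : 'M[R]_(m, n)) x y :
  bilform A x (a *: y) = a * bilform A x y.
Proof. by rewrite /bilform -scalemxAr mxE. Qed.

Lemma bilform_mulr m n k (A : 'M[R]_(m, n)) (B : 'M[R]_(n, k)) x y :
  bilform (A *m B) x y = bilform A x (B *m y).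
Proof. by rewrite /bilform !mulmxA. Qed.

Lemma bilform_mull m n k (A : 'M[R]_(k, m)) (B : 'M[R]_(k, n)) x y :
  bilform (A^T *m B) x y = bilform B (A *m x) y.
Proof. by rewrite /bilform trmx_mul !mulmxA. Qed.

Lemma bilform1C n (x y : 'cV[R]_n) : bilform 1%:M x y = bilform 1%:M y x.
Proof. by rewrite -{1}[1%:M]trmx1 bilform_trmx. Qed.

Lemma bilform_trmxE m n (A : 'M[R]_(m, n)) x z :
  bilform A^T x z = bilform 1%:M (A *m x) z.
Proof. by rewrite -bilform_mull mulmx1. Qed.

Lemma quadform_Sy n (X : 'M[R]_n) x : quadform (Sy X) x = 2 * bilform X x x.
Proof. by rewrite quadformE bilformDm bilform_trmx; ring. Qed.

Lemma bilform_col_mxm m1 m2 n (A : 'M[R]_(m1, n)) (B : 'M[R]_(m2, n)) x1 x2 y :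
  bilform (col_mx A B) (col_mx x1 x2) y = bilform A x1 y + bilform B x2 y.
Proof. by rewrite /bilform tr_col_mx mul_row_col mulmxDl mxE. Qed.

Lemma bilform_row_mxm m n1 n2 (A : 'M[R]_(m, n1)) (B : 'M[R]_(m, n2)) x y1 y2 :
  bilform (row_mx A B) x (col_mx y1 y2) = bilform A x y1 + bilform B x y2.
Proof. by rewrite /bilform -!mulmxA mul_row_col mulmxDr mxE. Qed.

Lemma quadform_symblock2 n1 n2 (A : 'M[R]_n1) (B : 'M[R]_(n1, n2))
    (D : 'M[R]_n2) x y :
  quadform (symblock2 A B D) (col_mx x y) =
    quadform A x + 2 * bilform B x y + quadform D y.
Proof.
rewrite quadformE /symblock2 /block_mx bilform_col_mxm !bilform_row_mxm.
by rewrite bilform_trmx !quadformE; ring.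
Qed.

Lemma quadform_symblock3 n1 n2 n3 (A : 'M[R]_n1) (B : 'M[R]_(n1, n2))
    (C : 'M[R]_(n1, n3)) (D : 'M[R]_n2) (E : 'M[R]_(n2, n3)) (K : 'M[R]_n3)
    x y z :
  quadform (symblock3 A B C D E K) (col_mx (col_mx x y) z) =
    quadform (symblock2 A B D) (col_mx x y)
    + 2 * (bilform C x z + bilform E y z) + quadform K z.
Proof. by rewrite [LHS]quadform_symblock2 bilform_col_mxm. Qed.

Lemma quadform_symblock2_ul n1 n2 (A : 'M[R]_n1) (B : 'M[R]_(n1, n2))
    (D : 'M[R]_n2) x y :
  quadform (symblock2 A B D) (col_mx x y) =
    quadform A x + quadform (symblock2 0 B D) (col_mx x y).
Proof. by rewrite !quadform_symblock2 [quadform 0 _]bilform0m; ring. Qed.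

End BilinearForm.

Lemma symmetricmx_trmx (R : realType) n (A : 'M[R]_n) :
  (A \is symmetricmx) = (A == A^T).
Proof. by rewrite is_hermitianmxE expr0 scale1r map_mx_id. Qed.

Lemma col_mx_neq0l (R : realType) n1 n2 (x : 'cV[R]_n1) (y : 'cV[R]_n2) :
  x != 0 -> col_mx x y != 0.
Proof. by rewrite col_mx_eq0 negb_and => ->. Qed.

Lemma unitmx_inj0 (R : realType) n (A : 'M[R]_n) :
  (forall x : 'cV[R]_n, A *m x = 0 -> x = 0) -> A \in unitmx.
Proof.
move=> A0; rewrite -unitmx_tr -row_free_unit -kermx_eq0.
apply/eqP/row_matrixP => i; rewrite row0; apply: trmx_inj; rewrite trmx0.
apply: A0; apply: trmx_inj.
by rewrite trmx_mul trmxK -row_mul mulmx_ker row0 trmx0.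
Qed.

Lemma posdefmx_unit (R : realType) n (A : 'M[R]_n) :
  posdefmx A -> A \in unitmx.
Proof.
move=> [_ Apos]; apply: unitmx_inj0 => x Ax0; apply: contraTeq isT => /Apos.
by rewrite /quadform -mulmxA Ax0 mulmx0 mxE ltxx.
Qed.

Lemma bilform1_mul (R : realType) n (A : 'M[R]_n) y :
  bilform 1%:M y (A *m y) = quadform A y.
Proof. by rewrite -bilform_mulr mul1mx. Qed.

Lemma quadform_invmx (R : realType) n (A : 'M[R]_n) y : A \in unitmx ->
  quadform A (invmx A *m y) = quadform (invmx A) y.
Proof.
move=> Au; rewrite [LHS]quadformE -bilform_mulr mulmxV // bilform1C.
exact: bilform1_mul.
Qed.

(** Completing the square in the third block: the linear and the quadratic part
    in [z = c *: (invmx T *m (P *m x + Q *m y))] are both multiples of the form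
    of [invmx T].  For [b != 0], [c = - a / b] is the critical point and gives
    the Schur complement. *)
Lemma quadform_symblock3_schur (R : realType) n1 n2 p (A : 'M[R]_n1)
    (B : 'M[R]_(n1, n2)) (D : 'M[R]_n2) (P : 'M[R]_(p, n1)) (Q : 'M[R]_(p, n2))
    (T : 'M[R]_p) (a b c : R) x y : T \in unitmx ->
  quadform (symblock3 A B (a *: P^T) D (a *: Q^T) (b *: T))
    (col_mx (col_mx x y) (c *: (invmx T *m (P *m x + Q *m y)))) =
  quadform (symblock2 A B D) (col_mx x y)
  + (2 * a * c + b * c ^+ 2) * quadform (invmx T) (P *m x + Q *m y).
Proof.
move=> Tu; rewrite quadform_symblock3 [quadform (b *: T) _]quadformE.
rewrite !(bilformZm, bilformZl, bilformZr) !bilform_trmxE -quadformE.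
rewrite quadform_invmx //; set q := P *m x + Q *m y.
rewrite -(bilform1_mul (invmx T)) [in RHS]/q bilformDl -/q; ring.
Qed.

(** * The multiplier inequality on the graph of the uncertainty *)

Lemma uncertainty_setP (R : realType) m p (T : 'M[R]_p)
    (Theta2 : 'M[R]_(p, m)) (Theta3 : 'M[R]_m) (Delta : 'M[R]_(m, p)) y :
  uncertainty_set T Theta2 Theta3 Delta ->
  0 <= quadform (symblock2 T Theta2 Theta3) (col_mx y (Delta *m y)).
Proof.
case=> _ /(_ y); rewrite !quadformE bilform_mulr bilform_mull.
by rewrite mul_col_mx mul1mx.
Qed.

(** A kernel vector [x] of [1%:M - Delta *m F] satisfies
    [x = Delta *m (F *m x)], which places [(F *m x, x)] on the graph of
    [Delta], where the multiplier is nonnegative. *)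
Lemma wellposed_unitmx (R : realType) m p (T : 'M[R]_p)
    (Theta2 F : 'M[R]_(p, m)) (Theta3 : 'M[R]_m) (Delta : 'M[R]_(m, p)) :
  (forall x, x != 0 ->
     quadform (symblock2 T Theta2 Theta3) (col_mx (F *m x) x) < 0) ->
  uncertainty_set T Theta2 Theta3 Delta -> 1%:M - Delta *m F \in unitmx.
Proof.
move=> neg Dunc; apply: unitmx_inj0 => x.
rewrite mulmxBl mul1mx -mulmxA => /eqP; rewrite subr_eq0 => /eqP xE.
apply: contraTeq (uncertainty_setP (F *m x) Dunc) => /neg.
by rewrite -xE -ltNge.
Qed.

(** In the feedback loop driven by [H *m xi], the output
    [w = invmx (1%:M - Delta *m F) *m Delta *m H *m xi] of the uncertainty
    solves [w = Delta *m (H *m xi + F *m w)]; the multiplier is therefore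
    nonnegative at [(H *m xi + F *m w, w)], and dropping its term leaves the
    negative definiteness. *)
Lemma robust_negdefmx (R : realType) n m p (T : 'M[R]_p)
    (Theta2 F : 'M[R]_(p, m)) (Theta3 : 'M[R]_m) (Phi : 'M[R]_n)
    (G : 'M[R]_(n, m)) (H : 'M[R]_(p, n)) (Delta : 'M[R]_(m, p)) (kappa : R) :
  Phi \is symmetricmx -> 0 < kappa ->
  (forall xi w, xi != 0 ->
     quadform Phi xi + 2 * bilform G xi w
     + kappa * quadform (symblock2 T Theta2 Theta3)
                 (col_mx (H *m xi + F *m w) w) < 0) ->
  1%:M - Delta *m F \in unitmx -> uncertainty_set T Theta2 Theta3 Delta ->
  negdefmx (Phi + Sy (G *m invmx (1%:M - Delta *m F) *m Delta *m H)).
Proof.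
move=> Phisym kappa0 neg DFu Dunc; split.
  move: Phisym; rewrite !symmetricmx_trmx => /eqP Phisym.
  by rewrite /Sy !linearD /= trmxK -Phisym [X in _ == _ + X]addrC.
move=> xi xi0; rewrite quadformE bilformDm -!quadformE quadform_Sy -!mulmxA.
rewrite bilform_mulr; set w := _ *m xi.
have wE : w = Delta *m (H *m xi + F *m w).
  apply/eqP; rewrite mulmxDr -subr_eq [Delta *m (F *m w)]mulmxA.
  by rewrite -{1}[w]mul1mx -mulmxBl /w -!mulmxA mulKVmx.
have := neg xi w xi0; have := uncertainty_setP (H *m xi + F *m w) Dunc.
rewrite -wE => /(mulr_ge0 (ltW kappa0)); lra.
Qed.

(** * Test vectors for the matrix inequalities *)

(** On the diagonal vectors [(x, x)] the identity blocks cancel. *)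
Lemma quadform_wellposed (R : realType) m p (Theta2 F : 'M[R]_(p, m))
    (Theta3 : 'M[R]_m) (alpha : R) x :
  quadform (symblock2 1%:M (- 1%:M - alpha *: (F^T *m Theta2))
                      (1%:M - alpha *: Theta3)) (col_mx x x) =
  - (alpha * quadform (symblock2 0 Theta2 Theta3) (col_mx (F *m x) x)).
Proof.
rewrite !quadform_symblock2 !quadformE !(bilformDm, bilformNm, bilformZm).
by rewrite bilform_mull bilform0m; ring.
Qed.

(** The [Theta2], [Theta3] terms are those of the multiplier pulled back along
    [(xi, w) |-> (H *m xi + F *m w, w)]; with upper-left block [0], nothing
    quadratic in [H *m xi + F *m w] appears. *)
Lemma quadform_robust (R : realType) n m p (Theta2 F : 'M[R]_(p, m))
    (Theta3 : 'M[R]_m) (Phi : 'M[R]_n) (G : 'M[R]_(n, m)) (H : 'M[R]_(p, n))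
    (kappa : R) xi w :
  quadform (symblock2 Phi (G + kappa *: (H^T *m Theta2))
     (kappa *: (F^T *m Theta2) + kappa *: (Theta2^T *m F) + kappa *: Theta3))
     (col_mx xi w) =
  quadform Phi xi + 2 * bilform G xi w
  + kappa * quadform (symblock2 0 Theta2 Theta3) (col_mx (H *m xi + F *m w) w).
Proof.
rewrite !quadform_symblock2 !quadformE !(bilformDm, bilformZm) bilform0m.
rewrite [bilform (Theta2^T *m F) w w]bilform_mulr bilform_trmx !bilform_mull.
by rewrite bilformDl; ring.
Qed.

Theorem lemma3p1 (R : realType) (n m p : nat)
    (Theta1 : 'M[R]_p) (Theta2 : 'M[R]_(p, m)) (Theta3 : 'M[R]_m)
    (Phi : 'M[R]_n) (G : 'M[R]_(n, m)) (H : 'M[R]_(p, n)) (F : 'M[R]_(p, m))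
    (calF : set 'M[R]_(m, p))
    (hTheta1 : posdefmx Theta1) (hTheta3 : negsemidefmx Theta3)
    (hPhi : Phi \is symmetricmx) :
  ((calF `<=` uncertainty_set (invmx Theta1) Theta2 Theta3)%classic ->
   (exists2 alpha : R, 0 < alpha &
      posdefmx (symblock3
        1%:M (- 1%:M - alpha *: (F^T *m Theta2)) (alpha *: F^T)
             (1%:M - alpha *: Theta3)            (0 : 'M[R]_(m, p))
                                                 (alpha *: Theta1))) ->
   (forall Delta, calF Delta -> 1%:M - Delta *m F \in unitmx) /\
   ((exists2 kappa : R, 0 < kappa &
       negdefmx (symblock3
         Phi (G + kappa *: (H^T *m Theta2))
             (kappa *: H^T)
             (kappa *: (F^T *m Theta2) + kappa *: (Theta2^T *m F)
                + kappa *: Theta3)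
             (kappa *: F^T)
             (- (kappa *: Theta1)))) ->
    forall Delta, calF Delta ->
      negdefmx (Phi + Sy (G *m invmx (1%:M - Delta *m F) *m Delta *m H))))
  /\
  ((calF `<=` uncertainty_set 0 Theta2 Theta3)%classic ->
   (exists2 alpha : R, 0 < alpha &
      posdefmx (symblock2
        1%:M (- 1%:M - alpha *: (F^T *m Theta2))
             (1%:M - alpha *: Theta3))) ->
   (forall Delta, calF Delta -> 1%:M - Delta *m F \in unitmx) /\
   ((exists2 kappa : R, 0 < kappa &
       negdefmx (symblock2
         Phi (G + kappa *: (H^T *m Theta2))
             (kappa *: (F^T *m Theta2) + kappa *: (Theta2^T *m F)
                + kappa *: Theta3))) ->
    forall Delta, calF Delta ->
      negdefmx (Phi + Sy (G *m invmx (1%:M - Delta *m F) *m Delta *m H)))).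
Proof.
have T1u := posdefmx_unit hTheta1.
split=> sub_unc [alpha alpha0 [_ hpos]].
- have unit_calF Delta : calF Delta -> 1%:M - Delta *m F \in unitmx.
    move=> /sub_unc; apply: wellposed_unitmx => x x0.
    (* The spurious [0 *m x] fits the vanishing (2,3) block to the general
       form of the completed square. *)
    have := hpos _ (col_mx_neq0l (-1 *: (invmx Theta1 *m (F *m x + 0 *m x)))
                                 (col_mx_neq0l x x0)).
    have -> : (0 : 'M[R]_(m, p)) = alpha *: (0 : 'M[R]_(p, m))^T.
      by rewrite trmx0 scaler0.
    rewrite quadform_symblock3_schur // mul0mx addr0 quadform_wellposed.
    rewrite [quadform (symblock2 (invmx _) _ _) _]quadform_symblock2_ul.
    rewrite -(pmulr_rlt0 _ alpha0); lra.
  split=> // -[kappa kappa0 [_ hneg]] Delta DF.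
  apply: (robust_negdefmx hPhi kappa0) (unit_calF _ DF) (sub_unc _ DF).
  move=> xi w xi0.
  have := hneg _ (col_mx_neq0l (1 *: (invmx Theta1 *m (H *m xi + F *m w)))
                               (col_mx_neq0l w xi0)).
  rewrite -scaleNr quadform_symblock3_schur // quadform_robust.
  rewrite [quadform (symblock2 (invmx _) _ _) _]quadform_symblock2_ul; lra.
- have unit_calF Delta : calF Delta -> 1%:M - Delta *m F \in unitmx.
    move=> /sub_unc; apply: wellposed_unitmx => x x0.
    have := hpos _ (col_mx_neq0l x x0).
    by rewrite quadform_wellposed oppr_gt0 pmulr_rlt0.
  split=> // -[kappa kappa0 [_ hneg]] Delta DF.
  apply: (robust_negdefmx hPhi kappa0) (unit_calF _ DF) (sub_unc _ DF).
  move=> xi w xi0.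
  by have := hneg _ (col_mx_neq0l w xi0); rewrite quadform_robust.
Qed.
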